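(* Among a chord and a cavex segment between two points, the chord length is smaller. That is, if $f:[c,d]\to\mathbb{R}$ is a cavex segment, then the length $\sqrt{(d-c)^2+(f(d)-f(c))^2}$ of the chord joining $(c,f(c))$ and $(d,f(d))$ is smaller than the arc-length of the cavex segment between these two points.
   Context: A curve is a continuous function $f:[a,b]\to\mathbb{R}$ such that a tangent exists for $f(x)$ on $[a,b]$. A cavex segment is the section of a curve over a closed interval on which it is either convex or concave. The arc-length is the distance between two points along a section of a curve.
   Formalization: For a straight cavex segment the chord and the arc-length coincide, so strict ''smaller'' fails; the theorem proves chord length ≤ arc-length for every cavex segment with c < d, and strictly smaller whenever the segment is not its own chord. *)

(* Defs.v *)
From mathcomp Require Import all_boot all_order all_algebra.
From mathcomp Require Import all_classical all_reals all_analysis.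
Set Implicit Arguments.
Unset Strict Implicit.
Unset Printing Implicit Defensive.
Import Order.TTheory GRing.Theory Num.Theory.
Import numFieldNormedType.Exports.
Local Open Scope classical_set_scope.
Local Open Scope ring_scope.

Definition secant_slope (R : realType) (f : R -> R) (x y : R) : R :=
  (f y - f x) / (y - x).

(* The tangent at [x] is the limiting position of the secant lines through [x]
   and the other points of the graph over [D]: either their slopes converge to
   a real number, or they become vertical (as for a half-circle at its ends).
   At an endpoint of an interval [D] this is a one-sided limit. *)
Definition has_tangent (R : realType) (D : set R) (f : R -> R) (x : R) : Prop :=
  (exists l : R, secant_slope f x y @[y --> within D x^'] --> l) \/
  `|secant_slope f x y| @[y --> within D x^'] --> +oo.

(* A curve over [a, b] is a function on R of which only the restriction to
   [a, b] is used. *)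
Definition is_curve (R : realType) (a b : R) (f : R -> R) : Prop :=
  {within `[a, b], continuous f} /\
  (forall x, x \in `[a, b] -> has_tangent `[a, b] f x).

Definition concave_function (R : realType) (D : set R) (f : R -> R) : Prop :=
  convex_function (D : set R^o) (fun x => - f x : R^o).

Definition cavex_segment (R : realType) (a b : R) (f : R -> R) (c d : R) :
    Prop :=
  [/\ is_curve a b f, `[c, d]%classic `<=` `[a, b]%classic &
      convex_function (`[c, d]%classic : set R^o) (f : R -> R^o) \/
      concave_function `[c, d] f].

Definition chord_length (R : realType) (f : R -> R) (x y : R) : R :=
  Num.sqrt ((y - x) ^+ 2 + (f y - f x) ^+ 2).

Definition chord_line (R : realType) (f : R -> R) (c d x : R) : R :=
  f c + secant_slope f c d * (x - c).

(* [s] lists the points of subdivision other than [c], so the vertices are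
   over [c :: s]; compare [variation]. *)
Definition polygon_length (R : realType) (c d : R) (f : R -> R) (s : seq R) :
    R :=
  let p := nth d (c :: s) in
  \sum_(0 <= n < size s) chord_length f (p n) (p n.+1).

Definition arc_length (R : realType) (c d : R) (f : R -> R) : \bar R :=
  ereal_sup [set (polygon_length c d f s)%:E | s in itv_partition c d].

(* Main.v *)
Require Import Defs.
From mathcomp Require Import all_boot all_order all_algebra.
From mathcomp Require Import all_classical all_reals all_analysis.
From mathcomp Require Import ring lra.
Set Implicit Arguments.
Unset Strict Implicit.
Unset Printing Implicit Defensive.
Import Order.TTheory GRing.Theory Num.Theory.
Import numFieldNormedType.Exports.
Local Open Scope classical_set_scope.
Local Open Scope ring_scope.

(** Arc-length is a supremum over inscribed polygons, and the chord is itself the one-edge polygon,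
    so it is never longer than the arc. If the graph leaves the chord line at some [x], the two-edge
    polygon through [x] is already longer than the chord by the strict triangle inequality
    ([ltr_sqrt_triangle], [chord_length_split_lt]). A straight segment is its own chord, hence the
    condition on strictness. *)

(** The hypothesis says that the cross product of the plane vectors (p, u) and (q, v) is nonzero. *)
Lemma ltr_sqrt_triangle (R : rcfType) (p q u v : R) (puv : p * v != q * u) :
  Num.sqrt ((p + q) ^+ 2 + (u + v) ^+ 2) <
  Num.sqrt (p ^+ 2 + u ^+ 2) + Num.sqrt (q ^+ 2 + v ^+ 2).
Proof.
have sq2_ge0 (x y : R) : 0 <= x ^+ 2 + y ^+ 2 by rewrite addr_ge0 ?sqr_ge0.
set A : R := Num.sqrt (p ^+ 2 + u ^+ 2); set B : R := Num.sqrt (q ^+ 2 + v ^+ 2).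
have A2 : A ^+ 2 = p ^+ 2 + u ^+ 2 by rewrite sqr_sqrtr.
have B2 : B ^+ 2 = q ^+ 2 + v ^+ 2 by rewrite sqr_sqrtr.
have A0 : 0 <= A by exact: sqrtr_ge0.
have B0 : 0 <= B by exact: sqrtr_ge0.
(* Lagrange's identity turns noncollinearity into a strict Cauchy-Schwarz. *)
have dot2_lt : (p * q + u * v) ^+ 2 < (A * B) ^+ 2.
  rewrite -subr_gt0.
  have -> : (A * B) ^+ 2 - (p * q + u * v) ^+ 2 = (p * v - q * u) ^+ 2.
    by ring: A2 B2.
  by rewrite lt0r sqr_ge0 sqrf_eq0 subr_eq0 puv.
have dot_lt : p * q + u * v < A * B.
  have AB0 : 0 <= A * B by exact: mulr_ge0.
  (* By contraposition: a dot product at least [A * B] is nonnegative, so squaring preserves the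
     order. *)
  apply: contraTT dot2_lt; rewrite -!leNgt => AB_le.
  by rewrite ler_pXn2r ?nnegrE ?(le_trans AB0).
have sum2_lt : (p + q) ^+ 2 + (u + v) ^+ 2 < (A + B) ^+ 2.
  have -> : (A + B) ^+ 2 = p ^+ 2 + u ^+ 2 + (A * B) *+ 2 + (q ^+ 2 + v ^+ 2).
    by ring: A2 B2.
  by lra.
by rewrite -[ltRHS]ger0_norm ?addr_ge0 // -sqrtr_sqr ltr_sqrt // (le_lt_trans _ sum2_lt).
Qed.

(** If the two edges had zero cross product, clearing the denominator [d - c] of the slope would put
    the vertex over [x] on the chord line. *)
Lemma chord_length_split_lt (R : realType) (f : R -> R) (c x d : R)
    (cd : c < d) (fx : f x != chord_line f c d x) :
  chord_length f c d < chord_length f c x + chord_length f x d.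
Proof.
rewrite /chord_length.
have -> : d - c = (x - c) + (d - x) by ring.
have -> : f d - f c = (f x - f c) + (f d - f x) by ring.
apply: ltr_sqrt_triangle; apply: contra fx => /eqP collinear.
have dc0 : d - c != 0 by rewrite subr_eq0 gt_eqF.
apply/eqP/(mulIf dc0); rewrite /chord_line /secant_slope.
by rewrite mulrDl mulrAC divfK //; lra.
Qed.

Lemma polygon_length_le_arc_length (R : realType) (c d : R) (f : R -> R)
    (s : seq R) :
  itv_partition c d s -> ((polygon_length c d f s)%:E <= arc_length c d f)%E.
Proof. by move=> cds; apply: ereal_sup_ubound; exists s. Qed.

Theorem corollary4 (R : realType) (a b c d : R) (f : R -> R)
    (cd : c < d) (cavex : cavex_segment a b f c d) :
  ((chord_length f c d)%:E <= arc_length c d f)%E /\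
  (~ (forall x, x \in `[c, d] -> f x = chord_line f c d x) ->
   ((chord_length f c d)%:E < arc_length c d f)%E).
Proof.
split.
  (* Partitions omit their left end [c], so [[:: d]] is the one with a single edge. *)
  have <- : polygon_length c d f [:: d] = chord_length f c d.
    by rewrite /polygon_length /= big_nat1.
  by apply: polygon_length_le_arc_length; split; rewrite /= ?cd.
move=> /existsNP[x /not_implyP[xcd /eqP fx]].
(* The chord line meets the graph at [c] and [d], so [x] differs from both, as a strictly increasing
   partition requires. *)
have cx : c < x.
  rewrite lt_neqAle (itvP xcd) andbT; apply: contra fx => /eqP <-.
  by rewrite /chord_line subrr mulr0 addr0.
have xd : x < d.
  rewrite lt_neqAle (itvP xcd) andbT; apply: contra fx => /eqP ->.
  by rewrite /chord_line /secant_slope divfK ?subr_eq0 ?(gt_eqF cd) // addrC subrK.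
have cxd : itv_partition c d [:: x; d] by split; rewrite /= ?cx ?xd.
apply: lt_le_trans (polygon_length_le_arc_length f cxd).
rewrite lte_fin /polygon_length /= big_nat_recr //= big_nat1.
exact: chord_length_split_lt.
Qed.
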